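(* Let $H$ be a Hilbert space, let $0\le\alpha<1$ satisfy $\alpha+\alpha^2+\alpha^3<1$, let $X$ be a paracompact space, and let $F:X\to bexp_\alpha(H)$ be a continuous mapping, where $bexp_\alpha(H)$ is the family of all bounded $\alpha$-paraconvex subsets of $H$ endowed with the Hausdorff metric. Then there exists a continuous singlevalued mapping $\mathfrak{F}:X\to C_b(H,H)$, $x\mapsto\mathfrak{F}_x$, such that for every $x\in X$ the mapping $\mathfrak{F}_x:H\to H$ is a continuous retraction of $H$ onto the set $F(x)$.
   Context: For a number $\alpha\ge 0$, a nonempty closed subset $P$ of a normed space $Y$ is called $\alpha$-paraconvex if for every $r>0$, every open ball $D_r\subset Y$ of radius $r$ and every $q\in \mathrm{conv}(P\cap D_r)$ one has $\mathrm{dist}(q,P)\le \alpha\cdot r$. For $0\le\alpha<1$, $bexp_\alpha(H)$ is the family of all $\alpha$-paraconvex bounded subsets of $H$ endowed with the Hausdorff metric; the Hausdorff distance between two bounded sets is the infimum of all $\varepsilon>0$ such that each of the sets is contained in the open $\varepsilon$-neighborhood of the other. $C_b(H,H)$ is the Banach space of all continuous bounded mappings of $H$ into itself, with the sup norm. A continuous retraction of $H$ onto $A\subset H$ is a continuous map $R:H\to H$ with $R(H)\subset A$ and $R(a)=a$ for all $a\in A$. *)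

(* Defs.v *)
From HB Require Import structures.
From mathcomp Require Import all_boot all_order all_algebra.
From mathcomp Require Import all_classical all_reals all_analysis.
From mathcomp Require Import ring.

Set Implicit Arguments.
Unset Strict Implicit.
Unset Printing Implicit Defensive.

Import Order.TTheory GRing.Theory Num.Theory.
Import numFieldNormedType.Exports.

Local Open Scope classical_set_scope.
Local Open Scope ring_scope.

(** Paracompact spaces are Hausdorff by convention. *)
Section paracompactness.
Context {T : topologicalType}.
Implicit Types U V : set (set T).

Definition locally_finite V :=
  forall x : T, exists2 N, nbhs x N &
    finite_set [set B | V B /\ B `&` N !=set0].

Definition refines V U := forall B, V B -> exists2 A, U A & B `<=` A.

Definition open_covering U :=
  (forall A, U A -> open A) /\ \bigcup_(A in U) A = setT.

End paracompactness.

Definition paracompact_space (T : topologicalType) :=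
  hausdorff_space T /\
  forall U : set (set T), open_covering U ->
    exists V, [/\ open_covering V, refines V U & locally_finite V].

Section paraconvexity.
Context {R : realType} {Y : normedModType R}.
Implicit Types (A P : set Y) (q : Y).

Definition convex_hull A : set Y := smallest (@convex_set R Y) A.

Definition dist q P : R := inf [set `|q - p| | p in P].

Definition paraconvex (alpha : R) P :=
  [/\ P !=set0, closed P &
    forall (r : R) (c q : Y), 0 < r ->
      convex_hull (P `&` ball c r) q -> dist q P <= alpha * r].

Definition nbhd A (e : R) : set Y := \bigcup_(a in A) ball a e.

(* The infimum is only meaningful for nonempty bounded sets, where the set of
   admissible [e] is nonempty. *)
Definition hausdorff_dist A P : R :=
  inf [set e | [/\ 0 < e, A `<=` nbhd P e & P `<=` nbhd A e]].

End paraconvexity.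

Record bexp (R : realType) (alpha : R) (Y : normedModType R) := Bexp {
  bexp_set :> set Y ;
  bexp_paraconvex : paraconvex alpha bexp_set ;
  bexp_bounded : bounded_set bexp_set }.

Section bexp_metric.
Context {R : realType} {alpha : R} {Y : normedModType R}.
Local Notation bexp := (bexp alpha Y).
Implicit Types P Q S : bexp.

HB.instance Definition _ := gen_eqMixin bexp.
HB.instance Definition _ := gen_choiceMixin bexp.

Let radii (A P : set Y) : set R :=
  [set e | [/\ 0 < e, A `<=` nbhd P e & P `<=` nbhd A e]].

Let radii_lb (A P : set Y) : lbound (radii A P) 0.
Proof. by move=> e [/ltW]. Qed.

Let hdist_ge0 (A P : set Y) : 0 <= hausdorff_dist A P.
Proof.
have [A0|/nonemptyPn A0] := pselect (radii A P !=set0).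
  by apply: lb_le_inf => //; exact: radii_lb.
by rewrite /hausdorff_dist -/(radii A P) A0 inf0.
Qed.

Let radii_neq0 P Q : radii P Q !=set0.
Proof.
case: P Q => [P [[p Pp] _ _] bP] [Q [[q Qq] _ _] bQ] /=.
have [M M0 PM] := ex_strict_bound_gt0 bP.
have [N N0 QN] := ex_strict_bound_gt0 bQ.
exists (M + N); split; first exact: addr_gt0.
- move=> x Px; exists q => //; rewrite -ball_normE /= distrC.
  by rewrite (le_lt_trans (ler_normB _ _))// ltrD//; [exact: PM|exact: QN].
- move=> x Qx; exists p => //; rewrite -ball_normE /=.
  by rewrite (le_lt_trans (ler_normB _ _))// ltrD//; [exact: PM|exact: QN].
Qed.

Let hdist_ltP P Q e : hausdorff_dist P Q < e ->
  P `<=` nbhd Q e /\ Q `<=` nbhd P e.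
Proof.
move=> /(inf_lt (radii_neq0 P Q)) [d [d0 PQ QP] de].
by split=> x /[dup] xP => [/PQ|/QP] [y yQ xy]; exists y => //;
  apply: le_ball xy; exact: ltW.
Qed.

Let hdist_le P Q e : 0 < e -> P `<=` nbhd Q e -> Q `<=` nbhd P e ->
  hausdorff_dist P Q <= e.
Proof. by move=> e0 PQ QP; apply: ge_inf => //; exists 0; exact: radii_lb. Qed.

Let hdistxx P : hausdorff_dist P P = 0.
Proof.
apply/eqP; rewrite eq_le hdist_ge0 andbT; apply/ler_addgt0Pl => e e0.
by rewrite addr0 hdist_le// => x Px; exists x => //; exact: ballxx.
Qed.

Let hdist_sub P Q : hausdorff_dist P Q = 0 -> P `<=` Q.
Proof.
move=> PQ0 x Px; have [_ /closure_id -> _] := bexp_paraconvex Q.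
move=> B /nbhs_ballP[e /= e0 eB].
have [|PQ _] := @hdist_ltP P Q e; first by rewrite PQ0.
have [y Qy xy] := PQ _ Px.
by exists y; split => //; apply/eB/ball_sym.
Qed.

Let hdist_sym P Q : hausdorff_dist P Q = hausdorff_dist Q P.
Proof. by congr inf; apply/seteqP; split=> e [? ? ?]; split. Qed.

Let hdist_eq P Q : hausdorff_dist P Q = 0 -> P = Q.
Proof.
move=> PQ; have {PQ} : bexp_set P = Q.
  by apply/seteqP; split; apply: hdist_sub; rewrite // hdist_sym.
case: P Q => [P p1 p2] [Q q1 q2] /= PQ; subst Q.
by congr Bexp; exact: Prop_irrelevance.
Qed.

Let nbhd_trans (A B C : set Y) d e :
  A `<=` nbhd B d -> B `<=` nbhd C e -> A `<=` nbhd C (d + e).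
Proof.
move=> AB BC x /AB[y /BC[z Cz zy] yx]; exists z => //.
by rewrite addrC; exact: ball_triangle zy yx.
Qed.

Let hdist_triangle Q P S :
  hausdorff_dist P S <= hausdorff_dist P Q + hausdorff_dist Q S.
Proof.
apply/ler_addgt0Pr => e e0.
have e20 : 0 < e / 2 by rewrite divr_gt0.
have [|PQ QP] := @hdist_ltP P Q (hausdorff_dist P Q + e / 2).
  by rewrite ltrDl.
have [|QS SQ] := @hdist_ltP Q S (hausdorff_dist Q S + e / 2).
  by rewrite ltrDl.
rewrite (splitr e) addrACA; apply: hdist_le.
- by rewrite addr_gt0// ltr_wpDl.
- exact: nbhd_trans PQ QS.
- by rewrite addrC; exact: nbhd_trans SQ QP.
Qed.

HB.instance Definition _ := isMetric.Build R bexp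
  hdistxx hdist_eq hdist_sym hdist_triangle.

End bexp_metric.

Section Cb_lmodule.
Context {R : realType} {T : topologicalType} {V : normedModType R}.

Definition cont_bounded : {pred T -> V} :=
  mem [set f : T -> V | continuous f /\ bounded_fun f].

Lemma cont_boundedP (f : T -> V) :
  reflect (continuous f /\ bounded_fun f) (f \in cont_bounded).
Proof. by apply: (iffP idP) => [/set_mem|/mem_set]. Qed.

Lemma cont_bounded_submod_closed : submod_closed cont_bounded.
Proof.
split; first by apply/cont_boundedP; split;
  [exact: cst_continuous|exact: (bounded_cst (0 : V))].
move=> a f g /cont_boundedP[cf bf] /cont_boundedP[cg bg].
apply/cont_boundedP; split.
  by move=> x; apply: cvgD; [apply: cvgZl_tmp; exact: cf|exact: cg].
have [M M0 fM] := ex_strict_bound_gt0 bf.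
have [N N0 gN] := ex_strict_bound_gt0 bg.
exists (`|a| * M + N); split=> [|e /ltW Me x _ /=]; first exact: num_real.
apply: le_trans Me; rewrite (le_trans (ler_normD _ _))// lerD//; last exact/ltW/gN.
by rewrite normrZ ler_wpM2l//; exact/ltW/fM.
Qed.

HB.instance Definition _ :=
  GRing.isSubmodClosed.Build R (T -> V) cont_bounded cont_bounded_submod_closed.

End Cb_lmodule.

Record Cb (R : realType) (T : topologicalType) (V : normedModType R) := MkCb {
  Cb_fun :> T -> V ;
  Cb_funP : Cb_fun \in cont_bounded }.

Section Cb_normed.
Context {R : realType} {T : topologicalType} {V : normedModType R}.
Local Notation Cb := (Cb T V).
Implicit Types f g : Cb.

HB.instance Definition _ := [isSub for @Cb_fun R T V].
HB.instance Definition _ := [Choice of Cb by <:].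
HB.instance Definition _ := [SubChoice_isSubLmodule of Cb by <:].

Definition sup_norm f : R := sup [set `|f x| | x in setT].

Let has_sup_norm f (x : T) : has_sup [set `|f x| | x in setT].
Proof.
split; first by exists `|f x|, x.
have [_ /ex_strict_bound_gt0[M _ fM]] := cont_boundedP _ (Cb_funP f).
by exists M => _ [y _ <-]; exact/ltW/fM.
Qed.

Lemma sup_norm_ub f x : `|f x| <= sup_norm f.
Proof. by apply: ub_le_sup; [exact: (has_sup_norm f x).2|exists x]. Qed.

Lemma sup_norm_ge0 f : 0 <= sup_norm f.
Proof.
have [[x _]|/nonemptyPn T0] := pselect ([set: T] !=set0).
  exact: le_trans (sup_norm_ub f x).
by rewrite /sup_norm T0 image_set0 sup0.
Qed.

Lemma sup_norm_le f e : 0 <= e -> (forall x, `|f x| <= e) -> sup_norm f <= e.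
Proof.
move=> e0 fe; have [[x _]|/nonemptyPn T0] := pselect ([set: T] !=set0).
  by apply: ge_sup => [|_ [y _ <-]//]; exists `|f x|, x.
by rewrite /sup_norm T0 image_set0 sup0.
Qed.

Let sup_normD f g : sup_norm (f + g) <= sup_norm f + sup_norm g.
Proof.
apply: sup_norm_le => [|x]; first by rewrite addr_ge0// sup_norm_ge0.
by rewrite (le_trans (ler_normD _ _))// lerD// sup_norm_ub.
Qed.

Let sup_normZ_le (l : R) f : sup_norm (l *: f) <= `|l| * sup_norm f.
Proof.
apply: sup_norm_le => [|x]; first by rewrite mulr_ge0// sup_norm_ge0.
by rewrite /= normrZ ler_wpM2l// sup_norm_ub.
Qed.

Let sup_normZ (l : R) f : sup_norm (l *: f) = `|l| * sup_norm f.
Proof.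
apply/eqP; rewrite eq_le sup_normZ_le/=.
have [->|l0] := eqVneq l 0; first by rewrite normr0 mul0r sup_norm_ge0.
rewrite mulrC -ler_pdivlMr ?normr_gt0// mulrC -normfV.
by rewrite -{1}(scalerK l0 f); exact: sup_normZ_le.
Qed.

Let sup_norm_eq0 f : sup_norm f = 0 -> f = 0.
Proof.
move=> f0; apply/val_inj/funext => x; apply/eqP.
by rewrite -normr_le0 -f0 sup_norm_ub.
Qed.

HB.instance Definition _ := Lmodule_isNormed.Build R Cb
  sup_normD sup_normZ sup_norm_eq0.

Lemma Cb_normE f : `|f| = sup [set `|f x| | x in setT].
Proof. by []. Qed.

End Cb_normed.

Section Cb_complete.
Context {R : realType} {T : topologicalType} {V : completeNormedModType R}.
Local Notation Cb := (Cb T V).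

Let Cb_ball (f g : Cb) (e : R) : ball f e g -> forall x, `|f x - g x| < e.
Proof.
by rewrite -ball_normE /= => fg x; apply: le_lt_trans fg; exact: (sup_norm_ub (f - g) x).
Qed.

Let Cb_complete (F : set_system Cb) : ProperFilter F -> cauchy F -> cvg F.
Proof.
move=> FF Fc.
have {}Fc e : 0 < e ->
    \forall f & g \near F, forall x, `|(f : Cb) x - (g : Cb) x| < e.
  move=> e0; have /cauchy_ballP /(_ e e0) := Fc.
  by apply: filterS => -[f g]; exact: Cb_ball.
have cvF x : cvg ((fun f : Cb => f x) @ F).
  apply: cauchy_cvg; apply/cauchy_ballP => e e0; near_simpl.
  rewrite near_map2; apply: filterS (Fc _ e0) => -[f g] /=; rewrite -ball_normE.
  exact.
pose l x : V := lim ((fun f : Cb => f x) @ F).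
have Fl e : 0 < e -> \forall f \near F, forall x, `|l x - (f : Cb) x| < e.
  move=> e0; have e20 : 0 < e / 2 by rewrite divr_gt0.
  apply: filterS (nearP_dep (Fc _ e20)) => f Ff x.
  have /cvgrPdist_lt/(_ _ e20) lx : (fun f : Cb => f x) @ F --> l x by exact: cvF.
  near F => g; rewrite (splitr e) (le_lt_trans (ler_distD (g x) _ _))// ltrD//.
    by near: g; exact: lx.
  by rewrite distrC; near: g; apply: filterS Ff => g /(_ x).
have cl : continuous l.
  move=> x; apply/cvgrPdist_lt => e e0.
  have e30 : 0 < e / 3 by rewrite divr_gt0.
  near F => f; have fl y : `|l y - (f : Cb) y| < e / 3.
    by move: y; near: f; exact: Fl.
  have [cf _] := cont_boundedP _ (Cb_funP f).
  move/cvgrPdist_lt/(_ _ e30) : (cf x); apply: filterS => y fxy.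
  have -> : l x - l y = (l x - f x) + (f x - f y) + (f y - l y).
    by rewrite -!addrA addKr addKr.
  have -> : e = e / 3 + e / 3 + e / 3 by field.
  rewrite (le_lt_trans (ler_normD _ _))// ltrD 1?distrC//.
  by rewrite (le_lt_trans (ler_normD _ _))// ltrD.
have bl : bounded_fun l.
  near F => f; have fl y : `|l y - (f : Cb) y| < 1.
    by move: y; near: f; exact: Fl.
  exists (1 + `|f|); split=> [|e /ltW fe x _ /=]; first exact: num_real.
  apply: le_trans fe; rewrite -(subrK (f x) (l x)) (le_trans (ler_normD _ _))//.
  by rewrite lerD ?(ltW (fl x))//; exact: sup_norm_ub.
have lP : l \in cont_bounded by exact/cont_boundedP.
apply/cvg_ex; exists (MkCb lP); apply/fcvgrPdist_lt => e e0.
have e20 : 0 < e / 2 by rewrite divr_gt0.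
apply: filterS (Fl _ e20) => f lf.
rewrite (@le_lt_trans _ _ (e / 2))//; last by rewrite gtr_pMr// invf_lt1// ltr1n.
by apply: sup_norm_le => [|x]; [exact: ltW|exact/ltW/lf].
Unshelve. all: by end_near. Qed.

HB.instance Definition _ := Uniform_isComplete.Build Cb Cb_complete.

End Cb_complete.

Definition retraction_onto (T : topologicalType) (A : set T) (r : T -> T) :=
  [/\ continuous r, range r `<=` A & forall a, A a -> r a = a].

(* Main.v *)
(** The space [bexp alpha H] is metric, so it suffices to choose continuously,
    for every [P] in it, a retraction [g P] of [H] onto [P], and then to compose
    with [F]. Michael's iteration for paraconvex sets is run simultaneously in
    [P] and [h], in the sup norm. An approximate retraction [f] keeps [f P h]
    within [r P] of [P], and [f P h] within [r P / 2] of [h] whenever [h] is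
    close to [P]. For a fixed [P], a partition of unity on [H] gives a
    continuous [v h] in the convex hull of the part of [P] in the ball of center
    [f P h] and radius [r P], with [v h] as close to [h] as we like when [h] is
    close enough to [P]; these two properties are convex in [v] and stable under
    small changes of [P], so a partition of unity on [bexp alpha H] glues such
    [v]'s. Paraconvexity puts the result within [(1 + alpha) / 2 * r P] of [P],
    and the iteration converges geometrically. The last condition on [f] is what
    makes the limit the identity on [P]. *)

Require Import Defs.
From mathcomp Require Import all_boot all_order all_algebra sesquilinear.
From mathcomp Require Import finmap.
From mathcomp Require Import all_classical all_reals all_analysis.
From mathcomp Require Import ring lra.
Import Order.TTheory GRing.Theory Num.Theory.
Import numFieldNormedType.Exports.
Local Open Scope classical_set_scope.
Local Open Scope ring_scope.
Set Implicit Arguments.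
Unset Strict Implicit.
Unset Printing Implicit Defensive.

(** * Well-orders and suprema of bounded families *)

Lemma well_order_le (T : choiceType) : exists le : rel T,
  [/\ total le, antisymmetric le &
    forall A : set T, A !=set0 -> exists2 i, A i & forall j, A j -> le i j].
Proof.
have [le wo] := wochoice.well_ordering_principle T.
have wc : wochoice.wo_chain le predT by move=> A _; exact: wo.
have lemin (A : set T) : A !=set0 -> exists2 i, A i & forall j, A j -> le i j.
  move=> [a Aa]; have [|i [[iA imin] _]] := wo (mem A).
    by exists a; exact/mem_set.
  by exists i => [|j Aj]; [exact/set_mem|exact/imin/mem_set].
have tot : total le by move=> x y; exact: (wochoice.wo_chainW wc).
have anti : antisymmetric le.
  by move=> x y; exact: (wochoice.wo_chain_antisymmetric wc).
by exists le.
Qed.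

Section lipschitz_sup.
Context {R : realType} {T : Type}.
Implicit Types (I : set T) (f : T -> R).

Lemma le_sup_img I f i (b : R) : (forall j, I j -> f j <= b) -> I i ->
  f i <= sup [set f j | j in I].
Proof.
move=> fb Ii; apply: ub_le_sup; last by exists i.
by exists b => _ [j Ij <-]; exact: fb.
Qed.

Lemma sup_img_le I f (b : R) : I !=set0 -> (forall j, I j -> f j <= b) ->
  sup [set f j | j in I] <= b.
Proof.
by move=> [i Ii] fb; apply: ge_sup => [|_ [j Ij <-]]; [exists (f i), i|exact: fb].
Qed.

End lipschitz_sup.

(** * Locally finite weights subordinate to balls *)

Section metric_partition.
Context {R : realType} {T : pseudoMetricType R} (d : T -> T -> R).
Hypothesis ball_d : forall x e, ball x e = [set y | d x y < e].
Context (rho : T -> R).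
Hypothesis rho_gt0 : forall i, 0 < rho i.
Hypothesis rho_le1 : forall i, rho i <= 1.

(** The metric axioms follow from those of balls, so [d] may be the norm distance of [H] as well as
    [mdist] on [bexp alpha H]. *)
Let d_sym x y : d x y = d y x.
Proof.
have le_sym u v : d v u <= d u v.
  apply/ler_addgt0Pr => e e0; apply: ltW.
  have : ball u (d u v + e) v by rewrite ball_d /= ltrDl.
  by move/ball_sym; rewrite ball_d.
by apply/eqP; rewrite eq_le !le_sym.
Qed.

Let d_triangle y x z : d x z <= d x y + d y z.
Proof.
apply/ler_addgt0Pr => e e0; apply: ltW.
have e20 : 0 < e / 2 by rewrite divr_gt0.
have xy : ball x (d x y + e / 2) y by rewrite ball_d /= ltrDl.
have yz : ball y (d y z + e / 2) z by rewrite ball_d /= ltrDl.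
by have := ball_triangle xy yz; rewrite ball_d /= addrACA -splitr.
Qed.

Let d_xx x : d x x = 0.
Proof.
apply/eqP; rewrite eq_le; apply/andP; split.
  apply/ler_addgt0Pr => e e0; rewrite add0r; apply: ltW.
  by have := ballxx x e0; rewrite ball_d.
by have := d_triangle x x x; rewrite lerDl.
Qed.

Let d_ge0 x y : 0 <= d x y.
Proof. by have := d_triangle y x x; rewrite d_xx (d_sym y x); lra. Qed.

Lemma lipschitz_continuous_at (f : T -> R) (k : R) : 0 < k ->
  (forall x y, f x <= f y + k * d x y) -> continuous f.
Proof.
move=> k0 fk x; apply/cvgrPdist_lt => e e0; near=> y.
have xy : k * d x y < e.
  rewrite mulrC -ltr_pdivlMr//; near: y.
  have : nbhs x (ball x (e / k)) by apply: nbhsx_ballx; rewrite divr_gt0.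
  by rewrite ball_d.
have := fk x y; have := fk y x; rewrite d_sym => ? ?.
by rewrite ltr_norml; apply/andP; split; lra.
Unshelve. all: by end_near. Qed.

(* The transfinite running suprema of the bumps [(rho i - d i x)^+] along a
   well-order of the centers increase from [0] to a positive bound; the jumps
   of this function are uniformly Lipschitz in [x], vanish off the balls, and at
   a given point only finitely many of them exceed a given positive number. *)
Lemma metric_locally_finite_weights : exists q : T -> T -> R,
  [/\ forall i, continuous (q i), forall i x, 0 <= q i x,
     forall i x, 0 < q i x -> d i x < rho i,
     forall x, exists i, 0 < q i x &
     forall x : T, exists A : {fset T},
       \forall y \near x, forall i, i \notin A -> q i y = 0].
Proof.
have [le [letot leanti lemin]] := well_order_le T.
pose b i x : R := Num.max 0 (rho i - d i x).
have b_ge0 i x : 0 <= b i x by rewrite le_max lexx.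
have b_le1 i x : b i x <= 1.
  by rewrite ge_max ler01 /=; have := rho_le1 i; have := d_ge0 i x; lra.
have b_lip i x y : b i x <= b i y + d x y.
  rewrite ge_max addr_ge0//=.
  have : rho i - d i y <= b i y by rewrite le_max lexx orbT.
  by have := d_triangle x i y; lra.
(* The zero at [j == i] turns [l i] into a supremum over strict predecessors, with an index set that
   is never empty. *)
pose c i j x : R := if j == i then 0 else b j x.
have c_ge0 i j x : 0 <= c i j x by rewrite /c; case: ifP.
have c_le1 i j x : c i j x <= 1 by rewrite /c; case: ifP.
have c_lip i j x y : c i j x <= c i j y + d x y.
  by rewrite /c; case: ifP => // _; rewrite add0r.
have lexx i : le i i by have := letot i i; rewrite orbb.
pose l i x := sup [set c i j x | j in [set j | le j i]].
have le_l i j x : le j i -> c i j x <= l i x.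
  by move=> ji; apply: (le_sup_img (f := fun j => c i j x) (b := 1)).
have l_le i x u : (forall j, le j i -> c i j x <= u) -> l i x <= u.
  by move=> cu; apply: (sup_img_le (f := fun j => c i j x)) => //; exists i => /=.
have l_ge0 i x : 0 <= l i x by rewrite (le_trans (c_ge0 i i x))// le_l.
have l_lip i x y : l i x <= l i y + d x y.
  by apply: l_le => j ji; rewrite (le_trans (c_lip _ _ _ y))// lerD2r le_l.
pose h i x := Num.max 0 (b i x - l i x).
have h_ge0 i x : 0 <= h i x by rewrite le_max Order.POrderTheory.lexx.
have h_lip i x y : h i x <= h i y + 2 * d x y.
  rewrite ge_max addr_ge0 ?mulr_ge0//=.
  have : b i y - l i y <= h i y by rewrite le_max Order.POrderTheory.lexx orbT.
  by have := b_lip i x y; have := l_lip i y x; rewrite (d_sym y x); lra.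
have h_le1 i x : h i x <= 1.
  by rewrite ge_max ler01 /=; have := b_le1 i x; have := l_ge0 i x; lra.
pose m x := sup [set h i x | i in setT].
have le_m i x : h i x <= m x.
  by apply: (le_sup_img (f := fun i => h i x) (b := 1)).
have m_le x u : (forall i, h i x <= u) -> m x <= u.
  by move=> hu; apply: (sup_img_le (f := fun i => h i x)) => //; exists x.
have m_lip x y : m x <= m y + 2 * d x y.
  by apply: m_le => i; rewrite (le_trans (h_lip _ _ y))// lerD2r.
have m_gt0 x : 0 < m x.
  (* At the first center whose bump is positive at [x], earlier bumps vanish, so the jump is the
     whole bump. *)
  have [|i bi imin] := lemin [set i | 0 < b i x].
    by exists x => /=; rewrite lt_max d_xx subr0 rho_gt0 orbT.
  apply: lt_le_trans (le_m i x); rewrite lt_max subr_gt0; apply/orP; right.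
  apply: le_lt_trans bi; apply: l_le => j ji; rewrite /c; case: eqP => // jni.
  rewrite leNgt; apply/negP => /imin ij; apply/jni/leanti.
  by rewrite ji.
(* If two jumps at [x] exceed [e], the later bump exceeds the earlier by more than [e]. Truncating
   [b i x / e] thus separates such indices, and it takes finitely many values. *)
have h_fin x e : 0 < e -> finite_set [set i | e < h i x].
  move=> e0; pose k i := Num.trunc (b i x / e).
  have b_sep i j : e < h i x -> le j i -> j != i -> b j x + e < b i x.
    rewrite lt_max ltNge (ltW e0)/= => ei ji jni.
    by have := le_l i j x ji; rewrite /c (negbTE jni); lra.
  have k_lt i j : b j x + e < b i x -> (k j < k i)%N.
    move=> ji; have bj0 : 0 <= b j x / e by rewrite divr_ge0 ?(ltW e0).
    rewrite /k truncn_gt_nat -natr1.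
    have /andP[+ _] := truncn_itv bj0; move=> kj.
    by rewrite (le_trans (y := b j x / e + 1)) ?lerD2r// ler_pdivlMr// mulrDl
      divfK ?gt_eqF// mul1r ltW.
  pose N := (Num.trunc e^-1).+1.
  have k_ltN i : (k i < N)%N.
    by rewrite ltnS le_truncn// ler_pdivrMr// mulVf ?gt_eqF.
  pose k' i := if e < h i x then k i else N.
  apply: (@sub_finite_set _ _ (k' @^-1` `I_N)) => [i /= ei|].
    by rewrite /k' ei k_ltN.
  apply: finite_preimage (finite_II N) => i j; rewrite !inE /= /k'.
  case: ifPn => [ei _|_]; last by rewrite ltnn.
  case: ifPn => [ej _|_]; last by rewrite ltnn.
  apply: contraPP => /eqP ij; apply/eqP.
  have /orP[le_ij|le_ji] := letot i j.
    by rewrite ltn_eqF// k_lt// b_sep.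
  by rewrite gtn_eqF// k_lt// b_sep// eq_sym.
(* Cutting at half of the positive supremum [m] leaves some jump positive, and only the finitely
   many that are comparable to [m]. *)
pose q i x := Num.max 0 (h i x - m x / 2).
have q_ge i x : h i x - m x / 2 <= q i x.
  by rewrite le_max Order.POrderTheory.lexx orbT.
have q_gt i x : 0 < q i x -> m x / 2 < h i x.
  by rewrite lt_max ltxx subr_gt0.
exists q; split.
- move=> i; apply: (@lipschitz_continuous_at _ 3) => // x y.
  rewrite ge_max addr_ge0 ?mulr_ge0 ?le_max ?Order.POrderTheory.lexx//=.
  have := q_ge i y; have := h_lip i x y; have := m_lip y x.
  by rewrite (d_sym y x); lra.
- by move=> i x; rewrite le_max Order.POrderTheory.lexx.
- move=> i x /q_gt; have := m_gt0 x => m0 mh.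
  have : 0 < h i x by lra.
  rewrite lt_max ltxx /= subr_gt0 => lb.
  have : 0 < b i x by rewrite (le_lt_trans _ lb).
  by rewrite lt_max ltxx /= subr_gt0.
- move=> x; apply: contrapT => /forallNP qx.
  have : m x <= m x / 2.
    apply: m_le => i; have := q_ge i x; have /negP := qx i; rewrite -leNgt.
    by lra.
  by have := m_gt0 x; lra.
(* The 2-Lipschitz bounds turn [m y / 2 < h i y] into [m x / 8 < h i x] when [d x y < m x / 16]. *)
- move=> x; have mx := m_gt0 x; have m80 : 0 < m x / 8 by lra.
  exists (fset_set [set i | m x / 8 < h i x]); near=> y => i.
  rewrite in_fset_set; last exact: h_fin.
  move/negP => hi.
  have xy : d x y < m x / 16.
    near: y; have : nbhs x (ball x (m x / 16)) by apply: nbhsx_ballx; lra.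
    by rewrite ball_d.
  apply/eqP; rewrite eq_le le_max Order.POrderTheory.lexx andbT leNgt.
  apply/negP => /q_gt qi; apply: hi; rewrite inE /=.
  by have := m_lip x y; have := h_lip i y x; rewrite (d_sym y x); lra.
Unshelve. all: by end_near. Qed.

End metric_partition.

(** * Convex combinations, hulls and neighborhoods *)

Section convexity.
Context {R : realType} {V : lmodType R}.
Implicit Types (A B : set V).

Lemma convex_setP A : @convex_set R V A <->
  forall x y t, 0 <= t -> t <= 1 -> A x -> A y -> A (t *: x + (1 - t) *: y).
Proof.
split=> [cA x y t t0 t1 Ax Ay|cA x y t /set_mem Ax /set_mem Ay].
  by have /set_mem := cA x y (Itv01 t0 t1) (mem_set Ax) (mem_set Ay).
by apply/mem_set/(cA x y t%:num).
Qed.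

Lemma convex_setI A B : @convex_set R V A -> @convex_set R V B ->
  @convex_set R V (A `&` B).
Proof.
move=> /convex_setP cA /convex_setP cB; apply/convex_setP => x y t t0 t1.
by move=> [? ?] [? ?]; split; [exact: cA|exact: cB].
Qed.

Lemma convex_combination (I : Type) (s : seq I) (w : I -> R) (v : I -> V) A :
  @convex_set R V A -> (forall i, 0 <= w i) -> (forall i, 0 < w i -> A (v i)) ->
  0 < \sum_(i <- s) w i ->
  A ((\sum_(i <- s) w i)^-1 *: \sum_(i <- s) w i *: v i).
Proof.
move=> /convex_setP cA w0 Av ws0.
suff [[ws _]|[]//] : (\sum_(i <- s) w i = 0 /\ \sum_(i <- s) w i *: v i = 0) \/
    (0 < \sum_(i <- s) w i /\
     A ((\sum_(i <- s) w i)^-1 *: \sum_(i <- s) w i *: v i)).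
  by rewrite ws ltxx in ws0.
elim: s {ws0} => [|i s IH]; first by left; rewrite !big_nil.
rewrite !big_cons; have := w0 i; rewrite le_eqVlt => /predU1P[<-|wi0].
  by rewrite scale0r !add0r.
right; case: IH => [[-> ->]|[ws0 Aws]].
  by rewrite !addr0 scalerA mulVf ?gt_eqF// scale1r; split=> //; exact: Av.
have wis0 : 0 < w i + \sum_(j <- s) w j by rewrite addr_gt0.
split=> //; rewrite scalerDr scalerA.
set W := \sum_(j <- s) w j in ws0 wis0 Aws *.
have -> : (w i + W)^-1 *: (\sum_(j <- s) w j *: v j) =
    (1 - (w i + W)^-1 * w i) *: (W^-1 *: \sum_(j <- s) w j *: v j).
  rewrite scalerA; congr (_ *: _).
  rewrite -{1}(mulVf (lt0r_neq0 wis0)) -mulrBr addrAC subrr add0r.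
  by rewrite mulfK// gt_eqF.
apply: cA => //; last exact: Av.
  by rewrite mulr_ge0 ?invr_ge0 ?ltW.
by rewrite mulrC ler_pdivrMr// mul1r lerDl ltW.
Qed.

End convexity.

Section hull_ball.
Context {R : realType} {V : normedModType R}.
Implicit Types (A B : set V).

Lemma convex_convex_hull A : @convex_set R V (convex_hull A).
Proof.
apply/convex_setP => x y t t0 t1 Ax Ay B [cB AB].
by have /convex_setP := cB; apply => //; [exact: Ax|exact: Ay].
Qed.

Lemma sub_convex_hull A : A `<=` convex_hull A.
Proof. by move=> x Ax B [_]; exact. Qed.

Lemma convex_hull_sub A B : @convex_set R V B -> A `<=` B ->
  convex_hull A `<=` B.
Proof. by move=> cB AB x; apply. Qed.

Lemma convex_ball (x : V) (e : R) : @convex_set R V (ball x e).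
Proof.
apply/convex_setP => y z t t0 t1; rewrite -ball_normE /= => xy xz.
have -> : x - (t *: y + (1 - t) *: z) = t *: (x - y) + (1 - t) *: (x - z).
  by rewrite !scalerBr addrACA -scalerDl subrKC scale1r opprD.
rewrite (le_lt_trans (ler_normD _ _))// !normrZ !ger0_norm ?subr_ge0//.
have [->|t_neq0] := eqVneq t 0; first by rewrite mul0r add0r subr0 mul1r.
have -> : e = t * e + (1 - t) * e by rewrite -mulrDl subrKC mul1r.
rewrite ltr_leD//; first by rewrite ltr_pM2l// lt0r t_neq0.
by rewrite ler_wpM2l ?subr_ge0// ltW.
Qed.

Lemma convex_nbhd A (e : R) : @convex_set R V A -> @convex_set R V (nbhd A e).
Proof.
move=> /convex_setP cA; apply/convex_setP => y z t t0 t1 [a Aa ay] [b Ab bz].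
exists (t *: a + (1 - t) *: b); first exact: cA.
have /convex_setP cb := @convex_ball 0 e.
move: ay bz; rewrite -!ball_normE /= => ay bz.
have := cb (y - a) (z - b) t t0 t1; rewrite -!ball_normE /= !sub0r !normrN.
rewrite (distrC y) (distrC z) !scalerBr addrACA -opprD => /(_ ay bz).
by rewrite distrC.
Qed.

End hull_ball.

(** * Selections of convex-valued maps *)

(** A value that stays admissible near [x] is used on a ball around [x]; weights subordinate to
    these balls average such values, and convexity of [C y] keeps the average admissible. *)
Lemma browder_selection (R : realType) (T : pseudoMetricType R)
    (d : T -> T -> R) (V : normedModType R) (C : T -> set V) :
  (forall x e, ball x e = [set y | d x y < e]) ->
  (forall x, @convex_set R V (C x)) ->
  (forall x : T, exists v, \forall y \near x, C y v) ->
  exists2 f : T -> V, continuous f & forall x, C x (f x).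
Proof.
move=> ball_d cC Cx.
have /choice[v /choice[rho vP]] : forall x, exists v : V, exists e : R,
    [/\ 0 < e, e <= 1 & ball x e `<=` [set y | C y v]].
  move=> x; have [v /nbhs_ballP[e /= e0 eC]] := Cx x.
  exists v, (Num.min e 1); split; first by rewrite lt_min e0 ltr01.
    by rewrite ge_min Order.POrderTheory.lexx orbT.
  by move=> y xy; apply: eC; apply: le_ball xy; rewrite ge_min lexx.
have rho0 x : 0 < rho x by have [] := vP x.
have rho1 x : rho x <= 1 by have [] := vP x.
have [q [q_cont q_ge0 q_supp q_ex q_fin]] :=
  metric_locally_finite_weights ball_d rho0 rho1.
(* By [q_fin], one finite index set serves a whole neighborhood, which reduces continuity to that of
   a finite sum. *)
pose W x : R := \sum_(i \in [set: T]) q i x.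
pose S x : V := \sum_(i \in [set: T]) q i x *: v i.
have WE (A : {fset T}) x : (forall i, i \notin A -> q i x = 0) ->
  W x = \sum_(i <- A) q i x by exact: fsbigTE.
have SE (A : {fset T}) x : (forall i, i \notin A -> q i x = 0) ->
  S x = \sum_(i <- A) q i x *: v i.
  by move=> qA; apply: fsbigTE => i /qA ->; rewrite scale0r.
have W_gt0 x : 0 < W x.
  have [A /nbhs_singleton qA] := q_fin x; have [i qi] := q_ex x.
  have iA : i \in A by apply/negPn/negP => /qA qi0; rewrite qi0 ltxx in qi.
  rewrite (WE A)// (big_fsetD1 i)//= ltr_wpDr// sumr_ge0//.
exists (fun x => (W x)^-1 *: S x) => x.
  have [A qA] := q_fin x.
  have Wx : W y @[y --> x] --> W x.
    rewrite (WE _ _ (nbhs_singleton qA)).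
    apply: (@cvg_trans _ (\sum_(i <- A) q i y @[y --> x])).
      by apply: near_eq_cvg; near=> y; rewrite (WE A)//; near: y.
    by apply: cvg_big => [|i _]; [exact: add_continuous|exact: q_cont].
  have Sx : S y @[y --> x] --> S x.
    rewrite (SE _ _ (nbhs_singleton qA)).
    apply: (@cvg_trans _ (\sum_(i <- A) q i y *: v i @[y --> x])).
      by apply: near_eq_cvg; near=> y; rewrite (SE A)//; near: y.
    apply: cvg_big => [|i _]; first exact: add_continuous.
    by apply: cvgZr_tmp; exact: q_cont.
  by apply: cvgZ => //; apply: cvgV => //; rewrite gt_eqF.
have [A /nbhs_singleton qA] := q_fin x.
rewrite (WE A)// (SE A)//; apply: convex_combination => //.
  move=> i /q_supp dix; have [_ _] := vP i; apply.
  by rewrite ball_d.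
by rewrite -(WE A).
Unshelve. all: by end_near. Qed.

(** * Approximate selection for one fixed set *)

Section near_identity.
Context {R : realType} {H : normedModType R}.
Implicit Types (P : set H) (f g : H -> H) (e r s : R).

(* The width [delta] depends on [P] and [f]: no uniform continuity of [f] is
   available, yet this is enough to survive small Hausdorff perturbations. *)
Definition near_id P f e := exists2 delta, 0 < delta &
  forall p h, P p -> `|p - h| < delta -> `|h - f h| < e.

(** Locally constant choices suffice: close to [P], a point of [P] near [h] also lies in the ball
    around [f h], as [f] moves [h] by less than [r / 2] there; far from [P], only the hull condition
    remains. *)
Lemma fiber_selection P f r s : continuous f -> 0 < r -> 0 < s ->
  (forall h, exists2 p, P p & `|f h - p| < r) -> near_id P f (r / 2) ->
  exists g, [/\ continuous g,
    forall h, convex_hull (P `&` ball (f h) r) (g h) & near_id P g s].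
Proof.
move=> cf r0 s0 fP [d1 d10 fid].
pose d := Num.min d1 (Num.min s (r / 2)) / 2.
have [d0 dd1 ds dr] : [/\ 0 < d, 2 * d <= d1, 2 * d <= s & 2 * d <= r / 2].
  rewrite /d mulrCA divff// mulr1 !ge_min !Order.POrderTheory.lexx !orbT.
  by rewrite divr_gt0// !lt_min d10 s0 divr_gt0.
pose C h := convex_hull (P `&` ball (f h) r) `&`
  [set z | (exists2 p, P p & `|p - h| < d) -> `|h - z| < s].
have [||h|g cg gC] := @browder_selection R H (fun x y => `|x - y|) H C.
- by move=> x e; rewrite -ball_normE.
- move=> h; apply: convex_setI; first exact: convex_convex_hull.
  have [hd|hd] := pselect (exists2 p, P p & `|p - h| < d); last first.
    by apply/convex_setP => x y t _ _ _ _ /hd.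
  have /convex_setP cb := @convex_ball _ _ h s.
  apply/convex_setP => x y t t0 t1 /(_ hd) xs /(_ hd) ys _.
  by have := cb x y t t0 t1; rewrite -ball_normE; apply.
(* If no point of [P] is within [2 * d] of [h], none is within [d] of any [y] with [|h - y| < d]. *)
- have [[p Pp hp]|hd] := pselect (exists2 p, P p & `|p - h| < 2 * d).
    exists p; near=> y.
    have py : `|p - y| < 2 * d.
      rewrite -(subrKA h) (le_lt_trans (ler_normD _ _))// -ltrBrDl.
      by near: y; apply: cvgr_dist_lt => //; rewrite subr_gt0.
    split=> [|_]; last by rewrite distrC (lt_le_trans py).
    apply: sub_convex_hull; split => //; rewrite -ball_normE /=.
    rewrite -(subrKA y) (le_lt_trans (ler_normD _ _))// (distrC y p).
    have := fid _ _ Pp (lt_le_trans py dd1); rewrite (distrC y).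
    by move=> ?; lra.
  have [p Pp fp] := fP h; exists p; near=> y; split => [|[p' Pp' yp']].
    apply: sub_convex_hull; split => //; rewrite -ball_normE /=.
    rewrite -(subrKA (f h)) (le_lt_trans (ler_normD _ _))// -ltrBrDr distrC.
    by near: y; apply: cvgr_dist_lt; [exact: cf|rewrite subr_gt0].
  exfalso; apply: hd; exists p' => //.
  have yh : `|h - y| < d by near: y; apply: cvgr_dist_lt.
  rewrite -(subrKA y) (le_lt_trans (ler_normD _ _))// mulr_natl mulr2n.
  by rewrite ltrD// distrC.
exists g; split=> // [h|]; first by have [] := gC h.
by exists d => // p h Pp ph; have [_] := gC h; apply; exists p.
Unshelve. all: by end_near. Qed.

End near_identity.

(** * Neighborhoods in the Hausdorff metric *)

Section hausdorff.
Context {R : realType} {alpha : R} {H : normedModType R}.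
Implicit Types P Q : bexp alpha H.

(** Boundedness makes [M + N] an admissible radius, so an infimum below [e] exhibits a radius below
    [e]. *)
Lemma mdist_lt_nbhd P Q (e : R) : mdist P Q < e ->
  bexp_set P `<=` nbhd Q e /\ bexp_set Q `<=` nbhd P e.
Proof.
have [p Pp] : bexp_set P !=set0 by have [] := bexp_paraconvex P.
have [q Qq] : bexp_set Q !=set0 by have [] := bexp_paraconvex Q.
have [M M0 PM] := ex_strict_bound_gt0 (bexp_bounded P).
have [N N0 QN] := ex_strict_bound_gt0 (bexp_bounded Q).
have far x y : bexp_set P x -> bexp_set Q y -> `|x - y| < M + N.
  move=> Px Qy; rewrite (le_lt_trans (ler_normB _ _))// ltrD//.
    exact: PM.
  exact: QN.
move=> /inf_lt[|d [_ PQ QP] /ltW de].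
  exists (M + N); split; first exact: addr_gt0.
    by move=> x Px; exists q => //; rewrite -ball_normE /= distrC far.
  by move=> y Qy; exists p => //; rewrite -ball_normE /= far.
split=> x.
  by move=> /PQ[y Qy xy]; exists y => //; exact: le_ball xy.
by move=> /QP[y Py xy]; exists y => //; exact: le_ball xy.
Qed.

Lemma near_nbhd P (e : R) : 0 < e ->
  nbhs P [set Q : bexp alpha H |
    bexp_set P `<=` nbhd Q e /\ bexp_set Q `<=` nbhd P e].
Proof.
move=> e0; have : nbhs P (ball P e) by exact: nbhsx_ballx.
by apply: filterS => Q; rewrite ballEmdist; exact: mdist_lt_nbhd.
Qed.

(** The infimum defining [dist] need not be attained, hence the slack [u]. *)
Lemma paraconvex_dist_lt P (c q : H) (r u : R) : 0 < r -> 0 < u ->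
  convex_hull (P `&` ball c r) q ->
  exists2 p, bexp_set P p & `|q - p| < alpha * r + u.
Proof.
move=> r0 u0 qP; have [[p Pp] _ /(_ r c q r0 qP) dqP] := bexp_paraconvex P.
have /inf_lt[|_ [y Py <-] qy] : dist q P < alpha * r + u.
- by rewrite (le_lt_trans dqP)// ltrDl.
- by exists `|q - p|, p.
- by exists y.
Qed.

End hausdorff.

Section Cb_dist.
Context {R : realType} {T : topologicalType} {V : normedModType R}.
Implicit Types f g : Cb T V.

Lemma Cb_dist_le f g x : `|f x - g x| <= `|f - g|.
Proof. exact: (sup_norm_ub (f - g) x). Qed.

Lemma le_Cb_dist f g (e : R) : 0 <= e -> (forall x, `|f x - g x| <= e) ->
  `|f - g| <= e.
Proof. exact: (@sup_norm_le _ _ _ (f - g)). Qed.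

End Cb_dist.

(** * One step of the iteration *)

Section iteration.
Context {R : realType} {alpha : R} {H : normedModType R}.
Hypotheses (alpha_ge0 : 0 <= alpha) (alpha_lt1 : alpha < 1).
Local Notation bexp := (bexp alpha H).
Implicit Types (P Q : bexp) (f : bexp -> Cb H H) (r : bexp -> R).

Definition approx_retraction f r :=
  [/\ continuous f, forall P h, exists2 p, bexp_set P p & `|f P h - p| < r P &
    forall P, near_id P (f P) (r P / 2)].

(** [gamma] equals [alpha + 4 * kappa], whereas a step leaves a distance factor
    [alpha * (1 + kappa) + 2 * kappa], at most [alpha + 3 * kappa]. *)
Let gamma := (1 + alpha) / 2.
Let kappa := (1 - alpha) / 8.

Lemma approx_retraction_step f r : continuous r -> (forall P, 0 < r P) ->
  approx_retraction f r -> exists2 g : bexp -> Cb H H,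
    approx_retraction g (fun P => gamma * r P) &
    forall P, `|g P - f P| <= 2 * r P.
Proof.
move=> cr r0 [cf fP fid]; have [a0 a1] := (alpha_ge0, alpha_lt1).
have k0 : 0 < kappa by rewrite /kappa; lra.
have k1 : kappa < 1 by rewrite /kappa; lra.
have g0 : 0 < gamma by rewrite /gamma; lra.
have kr0 P : 0 < kappa * r P by rewrite mulr_gt0.
(* The enlarged radius here and the neighborhood of the hull in [C] absorb the change from [P] to a
   nearby [Q]. *)
pose hull P h := convex_hull
  (bexp_set P `&` ball (f P h) ((1 + kappa) * r P)).
pose C P : set (Cb H H) := [set v |
  (forall h, nbhd (hull P h) (kappa * r P) (v h)) /\
  near_id P v (gamma * r P / 2)].
have [||P|g cg gC] := @browder_selection R bexp mdist (Cb H H) C.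
- by move=> P e; rewrite ballEmdist.
- move=> P; apply/convex_setP => v w t t0 t1 [vh [d1 d10 vid]] [wh [d2 d20 wid]].
  split=> [h|].
    have /convex_setP ch : @convex_set R H (nbhd (hull P h) (kappa * r P)).
      exact/convex_nbhd/convex_convex_hull.
    by have := ch _ _ t t0 t1 (vh h) (wh h).
  exists (Num.min d1 d2) => [|p h Pp]; first by rewrite lt_min d10 d20.
  rewrite lt_min => /andP[ph1 ph2].
  have /convex_setP cb := @convex_ball _ _ h (gamma * r P / 2).
  have := cb (v h) (w h) t t0 t1; rewrite -ball_normE /=; apply.
    exact: vid ph1.
  exact: wid ph2.
- have [cfP _] := cont_boundedP _ (Cb_funP (f P)).
  (* Half of the tolerance [gamma * r P / 2] is aimed at, since [r Q] may be smaller than [r P]. *)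
  have s0 : 0 < gamma * r P / 4 by rewrite divr_gt0// mulr_gt0.
  have [g [cg gh [d d0 gid]]] := fiber_selection cfP (r0 P) s0 (fP P) (fid P).
  have bg : bounded_fun g.
    have [M M0 PM] := ex_strict_bound_gt0 (bexp_bounded P).
    exists M; split=> [|e /ltW Me x _ /=]; first exact: num_real.
    apply: le_trans Me; apply: ltW.
    have : ball 0 M (g x).
      apply: convex_hull_sub (gh x); first exact: convex_ball.
      by move=> p [Pp _]; rewrite -ball_normE /= sub0r normrN PM.
    by rewrite -ball_normE /= sub0r normrN.
  have gP : g \in cont_bounded by exact/cont_boundedP.
  exists (MkCb gP).
  (* The tolerance [kappa * r Q] is then at least [7 * e], while the changes of [r], of [f] and of
     the set each cost at most [e]. *)
  pose e := kappa * r P / 8.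
  have e0 : 0 < e by rewrite divr_gt0.
  near=> Q.
  have rQ : `|r P - r Q| < e.
    by near: Q; apply: cvgr_dist_lt => //; exact: cr.
  have fQ : `|f P - f Q| < e.
    by near: Q; apply: cvgr_dist_lt => //; exact: cf.
  have [PQ _] : bexp_set P `<=` nbhd Q e /\ bexp_set Q `<=` nbhd P e.
    by near: Q; exact: near_nbhd.
  (* A point within [d / 2] of [Q] is then within [d] of [P], where [gid] applies. *)
  have [_ QP] : bexp_set P `<=` nbhd Q (d / 2) /\
      bexp_set Q `<=` nbhd P (d / 2).
    by near: Q; apply: near_nbhd; rewrite divr_gt0.
  have {}rQ : r P - e < r Q by move: rQ; rewrite ltr_norml => /andP[_]; lra.
  have ke : kappa * e <= e by rewrite ler_piMl ?ltW.
  have krPQ : kappa * r P - kappa * e <= kappa * r Q.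
    by rewrite -mulrBr ler_pM2l// ltW.
  have re : kappa * r P = 8 * e by rewrite /e; lra.
  have er : 8 * e <= r P by rewrite -re ler_piMl ?ltW.
  split=> [h|].
    apply: convex_hull_sub (gh h).
      exact/convex_nbhd/convex_convex_hull.
    move=> p [/PQ[q Qq qp]]; rewrite -ball_normE /= => hp.
    exists q; last by apply: le_ball qp; lra.
    apply: sub_convex_hull; split=> //; move: qp; rewrite -!ball_normE /= => qp.
    have fh := le_lt_trans (Cb_dist_le (f P) (f Q) h) fQ.
    have -> : f Q h - q = (f Q h - f P h) + (f P h - p) + (p - q).
      by rewrite -!addrA !addKr.
    rewrite (le_lt_trans (ler_normD _ _))//.
    have := ler_normD (f Q h - f P h) (f P h - p).
    rewrite (distrC (f Q h)) (distrC p) mulrDl mul1r.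
    by lra.
  exists (d / 2) => [|q h /QP[p Pp]]; first by rewrite divr_gt0.
  rewrite -ball_normE /= => pq qh.
  have /gid : bexp_set P p by [].
  move=> /(_ h); rewrite -(subrKA q) => gid'.
  have {gid'} := gid' (le_lt_trans (ler_normD _ _) _).
  rewrite [d]splitr ltrD// => /(_ isT) /lt_le_trans; apply.
  by rewrite -!mulrA ler_pM2l//; lra.
have gf P h : exists2 q, hull P h q & `|q - g P h| < kappa * r P.
  have [/(_ h)[q qP qg] _] := gC P; exists q => //.
  by move: qg; rewrite -ball_normE.
exists g; first split=> // [P h|P].
- have [q qP qg] := gf P h.
  have r1 : 0 < (1 + kappa) * r P by rewrite mulr_gt0// addr_gt0.
  have [p Pp qp] := paraconvex_dist_lt r1 (kr0 P) qP.
  exists p => //; rewrite -(subrKA q) (le_lt_trans (ler_normD _ _))// distrC.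
  apply: lt_le_trans (ltrD qg qp) _.
  have -> : kappa * r P + (alpha * ((1 + kappa) * r P) + kappa * r P) =
    (kappa + (alpha * (1 + kappa) + kappa)) * r P by ring.
  rewrite ler_pM2r//.
  have : alpha * kappa <= kappa by rewrite ler_piMl ?ltW.
  by rewrite mulrDr mulr1 /gamma /kappa; lra.
- by have [] := gC P.
- move=> P; apply: le_Cb_dist => [|h]; first by rewrite mulr_ge0// ltW.
  have [q qP qg] := gf P h.
  have : ball (f P h) ((1 + kappa) * r P) q.
    by apply: convex_hull_sub qP => [|p []//]; exact: convex_ball.
  rewrite -ball_normE /= => fq; rewrite -(subrKA q).
  rewrite (le_trans (ler_normD _ _))// (distrC (g P h)) (distrC q (f P h)).
  apply: le_trans (lerD (ltW qg) (ltW fq)) _.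
  have : kappa * r P <= 1 / 2 * r P by rewrite ler_pM2r// /kappa; lra.
  by rewrite mulrDl mul1r; lra.
Unshelve. all: by end_near. Qed.

End iteration.

(** * Passage to the limit *)

(** The tail [b n] of the geometric series has the step bounds as differences, so the estimate
    telescopes. *)
Lemma geometric_cauchy_lim (R : realType) (V : completeNormedModType R)
    (u : nat -> V) (a z : R) : 0 <= a -> 0 < z -> z < 1 ->
  (forall n, `|u n.+1 - u n| <= a * z ^+ n) ->
  exists l : V, forall n, `|l - u n| <= a / (1 - z) * z ^+ n.
Proof.
move=> a0 z0 z1 uz; pose b n := a / (1 - z) * z ^+ n.
have z10 : 0 < 1 - z by rewrite subr_gt0.
have b0 n : 0 <= b n.
  exact: mulr_ge0 (divr_ge0 a0 (ltW z10)) (exprn_ge0 _ (ltW z0)).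
have bS n : a * z ^+ n = b n - b n.+1.
  by rewrite /b exprS; field; rewrite gt_eqF.
have ub n k : `|u (k + n)%N - u n| <= b n.
  suff : `|u (k + n)%N - u n| <= b n - b (k + n)%N by have := b0 (k + n)%N; lra.
  elim: k => [|k IH]; first by rewrite add0n !subrr normr0.
  rewrite addSn -(subrKA (u (k + n)%N)) (le_trans (ler_normD _ _))//.
  by have := uz (k + n)%N; rewrite bS; lra.
have b_cvg0 : b n @[n --> \oo] --> 0.
  by apply: cvg_geometric; rewrite ger0_norm ?ltW.
have bsmall e : 0 < e -> exists n, b n < e.
  move=> e0; have /cvgrPdist_lt/(_ _ e0)[n _ /(_ n (leqnn n))] := b_cvg0.
  by rewrite /= sub0r normrN ger0_norm// => bn; exists n.
have : cvg (u n @[n --> \oo]).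
  apply: cauchy_cvg; apply: cauchy_exP => e e0.
  have [n bn] := bsmall e e0; exists (u n), n => // m /= nm.
  rewrite -ball_normE /= distrC (le_lt_trans _ bn)//.
  by have := ub n (m - n)%N; rewrite subnK.
move=> /cvg_ex[l ul]; exists l => n; apply/ler_addgt0Pl => e e0.
have /cvgrPdist_lt/(_ _ e0)[m _ lm] := ul.
have := lm (m + n)%N (leq_addr _ _) => /= lmn.
rewrite -(subrKA (u (m + n)%N)) (le_trans (ler_normD _ _))//.
by rewrite lerD ?(ltW lmn)//; exact: ub.
Qed.

(** Admissible radii form a convex set, and [M + 2] serves every [Q] contained in the 1-neighborhood
    of [P], so local bounds can be glued. *)
Lemma bexp_radius (R : realType) (alpha : R) (H : normedModType R) :
  exists2 r : bexp alpha H -> R, continuous r &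
    forall P p, bexp_set P p -> `|p| + 1 <= r P.
Proof.
pose C (P : bexp alpha H) : set R^o :=
  [set s | forall p, bexp_set P p -> `|p| + 1 <= s].
have [||P|r cr rC] := @browder_selection R (bexp alpha H) mdist R^o C.
- by move=> P e; rewrite ballEmdist.
- move=> P; apply/convex_setP => x y t t0 t1 xC yC p Pp.
  have -> : `|p| + 1 = t * (`|p| + 1) + (1 - t) * (`|p| + 1) by ring.
  by rewrite lerD// ler_wpM2l ?subr_ge0//; [exact: xC|exact: yC].
- have [M M0 PM] := ex_strict_bound_gt0 (bexp_bounded P).
  exists (M + 2); apply: filterS (near_nbhd P ltr01) => Q [_ QP] q /QP[p Pp].
  rewrite -ball_normE /= => pq; have /= pM := PM _ Pp.
  have := ler_normB p (p - q); rewrite opprB addrC subrK; lra.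
by exists r.
Qed.

(* The radius has to be continuous in [P] because the diameters of the members
   of [bexp alpha H] are not bounded; twice the radius leaves the margin that
   [approx_retraction] asks of the constant map [0]. *)
Lemma continuous_retraction_selection (R : realType) (alpha : R)
    (H : completeNormedModType R) : 0 <= alpha -> alpha < 1 ->
  exists2 g : bexp alpha H -> Cb H H, continuous g &
    forall P : bexp alpha H, retraction_onto P (g P).
Proof.
move=> a0 a1; pose z : R := (1 + alpha) / 2.
have z0 : 0 < z by rewrite /z; lra.
have z1 : z < 1 by rewrite /z; lra.
have [r0 cr0 r0P] := bexp_radius alpha H.
have r0_ge1 P : 1 <= r0 P.
  have [[p Pp] _ _] := bexp_paraconvex P; apply: le_trans (r0P _ _ Pp).
  by rewrite lerDr.
pose r n P : R := z ^+ n * (2 * r0 P).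
have r_gt0 n P : 0 < r n P.
  by rewrite !mulr_gt0 ?exprn_gt0// (lt_le_trans ltr01).
have cr n : continuous (r n).
  have -> : r n = *%R (z ^+ n * 2) \o r0.
    by apply/funext => P; rewrite /r /= mulrA.
  by move=> P; apply: continuous_comp; [exact: cr0|exact: mulrl_continuous].
(* [step] is chosen for arbitrary maps, with a conditional promise, so the recursion is defined
   before its invariant is proved. *)
have /choice[step stepP] (nf : nat * (bexp alpha H -> Cb H H)) :
    exists g : bexp alpha H -> Cb H H, approx_retraction nf.2 (r nf.1) ->
      approx_retraction g (r nf.1.+1) /\
      forall P, `|g P - nf.2 P| <= 2 * r nf.1 P.
  have [ar|nar] := pselect (approx_retraction nf.2 (r nf.1)); last first.
    by exists nf.2.
  have [g gar gf] := approx_retraction_step a0 a1 (cr _) (r_gt0 _) ar.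
  exists g => _; split; last exact: gf.
  suff -> : r nf.1.+1 = fun P => z * r nf.1 P by exact: gar.
  by apply/funext => P; rewrite /r exprS -mulrA.
pose u := fix u n : bexp alpha H -> Cb H H :=
  if n is m.+1 then step (m, u m) else fun=> 0.
have u_approx n : approx_retraction (u n) (r n).
  elim: n => [|n /(stepP (n, u n))[]//]; rewrite /r expr0; split.
  - exact: cst_continuous.
  - move=> P h; have [[p Pp] _ _] := bexp_paraconvex P; exists p => //=.
    rewrite sub0r normrN mul1r; have := r0P _ _ Pp; have := r0_ge1 P; lra.
  - move=> P; exists 1 => // p h Pp ph /=.
    rewrite subr0; have := r0P _ _ Pp.
    have := ler_normB p (p - h); rewrite opprB addrC subrK; lra.
have u_step n P : `|u n.+1 P - u n P| <= 4 * r0 P * z ^+ n.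
  have [_ /(_ P)] := stepP (n, u n) (u_approx n).
  by rewrite /= /r mulrCA mulrC !mulrA -natrM.
pose K : R := 4 / (1 - z).
have K0 : 0 < K by rewrite divr_gt0// subr_gt0.
have /choice[g gu] P : exists l, forall n, `|l - u n P| <= K * r0 P * z ^+ n.
  have r4 : 0 <= 4 * r0 P by rewrite mulr_ge0// (le_trans ler01).
  have [l lu] := geometric_cauchy_lim r4 z0 z1 (u_step^~ P).
  by exists l => n; rewrite [K * _]mulrAC.
have small (c e : R) : 0 < e -> exists n, c * z ^+ n < e.
  move=> e0; have : geometric c z @ \oo --> 0.
    by apply: cvg_geometric; rewrite ger0_norm ?ltW.
  move=> /cvgrPdist_lt/(_ _ e0)[n _ /(_ n (leqnn n))].
  by rewrite /= sub0r normrN => /ltr_normlW cn; exists n.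
have gr P n h : `|g P h - u n P h| <= K / 2 * r n P.
  apply: le_trans (Cb_dist_le _ _ _) _; apply: le_trans (gu P n) _.
  by rewrite /r le_eqVlt; apply/orP; left; apply/eqP; field.
exists g => [P|P].
  apply/(@cvgrPdist_lt _ _ _ (nbhs P)) => e e0.
  have e30 : 0 < e / 3 by rewrite divr_gt0.
  (* The bound in [gu] depends on [r0]; as [r0 Q <= r0 P + 1] near [P], one [n] serves all nearby
     [Q]. *)
  have [n ne] := small (K * (r0 P + 1)) _ e30; have [cu _ _] := u_approx n.
  near=> Q.
  have rQ : r0 Q <= r0 P + 1.
    have : `|r0 P - r0 Q| < 1 by near: Q; apply: cvgr_dist_lt => //; exact: cr0.
    by rewrite ltr_norml => /andP[]; lra.
  have uQ : `|u n P - u n Q| < e / 3.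
    by near: Q; apply: cvgr_dist_lt => //; exact: cu.
  have bnd S : r0 S <= r0 P + 1 -> `|g S - u n S| < e / 3.
    move=> rS; apply: le_lt_trans (gu S n) _; apply: le_lt_trans ne.
    by rewrite ler_pM2r ?exprn_gt0// ler_pM2l.
  have gP : `|g P - u n P| < e / 3 by apply: bnd; rewrite lerDl.
  have gQ := bnd _ rQ.
  rewrite -(subrKA (u n P)) -(subrKA (u n Q) (u n P)).
  have -> : e = e / 3 + (e / 3 + e / 3) by field.
  rewrite (le_lt_trans (ler_normD _ _))// ltrD//.
  by rewrite (le_lt_trans (ler_normD _ _))// ltrD// distrC.
have [cg _] := cont_boundedP _ (Cb_funP (g P)).
(* [K / 2] accounts for the distance from [g P h] to [u n P h], and [1] for that from [u n P h] to
   [P], or to [h] itself when [h] is in [P]. *)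
have r_small e : 0 < e -> exists n, (K / 2 + 1) * r n P < e.
  move=> e0; have [n ne] := small ((K / 2 + 1) * (2 * r0 P)) e e0.
  by exists n; rewrite /r (mulrC (z ^+ n)) mulrA.
split=> // [_ [h _ <-]|p Pp].
  have [_ Pcl _] := bexp_paraconvex P; apply: Pcl => B /nbhs_ballP[e /= /r_small[n ne] eB].
  have [_ /(_ P h)[p Pp up] _] := u_approx n.
  exists p; split=> //; apply: eB; rewrite -ball_normE /=.
  rewrite -(subrKA (u n P h)) (le_lt_trans (ler_normD _ _))//.
  by have := gr P n h; move: ne; rewrite mulrDl mul1r; lra.
apply/eqP; rewrite -subr_eq0 -normr_le0; apply/ler_addgt0Pl => e.
(* Closeness to the identity is applied at [h = p], at distance zero from [P], so the unknown width
   [d] is harmless. *)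
move=> /r_small[n ne]; have [_ _ /(_ P)[d d0 /(_ p p Pp)]] := u_approx n.
rewrite subrr normr0 => /(_ d0) up; rewrite addr0 -(subrKA (u n P p)).
rewrite (le_trans (ler_normD _ _))// (distrC _ p).
by have := gr P n p; have := r_gt0 n P; move: ne; rewrite mulrDl mul1r; lra.
Unshelve. all: by end_near. Qed.

Theorem theorem3p0 (R : realType)
    (H : completeNormedModType R) (dot : {dot H for idfun})
    (dot_norm : forall u : H, dot u u = `|u| ^+ 2)
    (alpha : R) (alpha_ge0 : 0 <= alpha) (alpha_lt1 : alpha < 1)
    (alpha_sum : alpha + alpha ^+ 2 + alpha ^+ 3 < 1)
    (X : topologicalType) (X_paracompact : paracompact_space X)
    (F : X -> bexp alpha H) (F_continuous : continuous F) :
  exists FF : X -> Cb H H,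
    continuous FF /\ forall x : X, retraction_onto (F x) (FF x).
Proof.
have [g cg gP] := continuous_retraction_selection H alpha_ge0 alpha_lt1.
exists (g \o F); split=> [x|x]; last exact: gP.
by apply: continuous_comp; [exact: F_continuous|exact: cg].
Qed.
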